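(* Let $\mathcal{A}=\{a_1,\dots,a_n\}\subseteq\mathbb{R}^k$ be a finite set and suppose that the barycenter problem with cutoff $\mathrm{Bar}_C(\mathcal{A})$ can be solved in $h_C(n)$ time. Then the tangent-line algorithm $\mathsf{T}$ described in the context computes the function $g:\mathbb{R}_+\to\mathbb{R}$, $g(C)=\min_{\xi\in\mathbb{R}^k} f_C(\xi,\mathcal{A})$, in $\mathcal{O}(n\cdot h_C(n))$ time.
   Context: $d$ is a metric on $\mathbb{R}^k$, $q\ge1$, $d^q(x,y)=(d(x,y))^q$, and $f_C(x,\mathcal{A})=\sum_{a\in\mathcal{A}}\min\{d^q(x,a),C\}$. The problem $\mathrm{Bar}_C(\mathcal{A})$ is to minimize $f_C(\cdot,\mathcal{A})$ over $\mathbb{R}^k$; its optimal value is $\mathcal{Z}_C^*$, so $g(C)=\mathcal{Z}_C^*$. For $x\in\mathbb{R}^k$ let $\mathrm{active}_C(x)=\{a\in\mathcal{A}: d^q(x,a)\le C\}$; when $C$ is clear, the index is omitted. The function $g$ is continuous, non-decreasing, concave and piecewise linear, with at most $n$ linear pieces, whose slopes are integers between $0$ and $n-1$. The function $\mathtt{bar}(C,\mathcal{A})$ returns an optimal solution $\xi_C^*$ of $\mathrm{Bar}_C(\mathcal{A})$ and the value $\mathcal{Z}_C^*$; $\mathtt{bar}(\infty,\mathcal{A})$ returns an optimal solution, and the optimal value, of the problem without cutoff, i.e. of minimizing $\sum_{a\in\mathcal{A}}d^q(x,a)$ over $x\in\mathbb{R}^k$. Algorithm $\mathsf{T}$. Input: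 $\mathcal{A}=\{a_1,\dots,a_n\}$. Output: the function $g$ (given through points on its graph, in particular its kinks) and barycenters corresponding to the different values of $C$. The set $\mathcal{S}$ contains the slopes of the lines already found, $\mathfrak{O}$ the slopes that may still be found; $l_i$ denotes a line of slope $i$, determined by $i$ and one point on it. 1. Set $\mathcal{S}\leftarrow\{0,n-1\}$ and $\mathfrak{O}\leftarrow\{1,\dots,n-2\}$. Set $(\xi_0^*,\mathcal{Z}_0^* )\leftarrow\mathtt{bar}(\infty,\mathcal{A})$ and $(\xi_{n-1}^*,\mathcal{Z}_{n-1}^* )\leftarrow(a_1,0)$. Let $l_0$ be the line through $(0,\mathcal{Z}_0^* )$ with slope $0$ and $l_{n-1}$ the line through $(0,0)$ with slope $n-1$. 2. While $\mathfrak{O}\ne\emptyset$: take the smallest $o\in\mathfrak{O}$, the largest $i\in\mathcal{S}$ with $i<o$ and the smallest $j\in\mathcal{S}$ with $o<j$. Compute the intersection point $(C,y)$ of $l_i$ and $l_j$ and $(\xi_C^*,\mathcal{Z}_C^* )\leftarrow\mathtt{bar}(C,\mathcal{A})$. If $\mathcal{Z}_C^*=y$, set $\mathfrak{O}\leftarrow\mathfrak{O}\setminus\{i+1,\dots,j-1\}$. Otherwise set $m\leftarrow|\mathrm{active}(\xi_C^* )|$, $\xi_{n-m}^*\leftarrow\xi_C^*$, $\mathcal{Z}_{n-m}^*\leftarrow\mathcal{Z}_C^*$, let $l_{n-m}$ be the line through $(C,\mathcal{Z}_{n-m}^* )$ with slope $n-m$, and set $\mathfrak{O}\leftarrow\mathfrak{O}\setminus\{n-m\}$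 and $\mathcal{S}\leftarrow\mathcal{S}\cup\{n-m\}$. 3. For each $i\in\mathcal{S}\setminus\{n-1\}$: let $j=\min\{k\in\mathcal{S}: k>i\}$ and compute the intersection point $(C_i,g(C_i))$ of $l_i$ and $l_j$. Set $(C_{n-1},g(C_{n-1}))\leftarrow(0,0)$. 4. Return $\{(C_i,g(C_i)): i\in\mathcal{S}\}$ and $\{\xi_i^*: i\in\mathcal{S}\}$.
   Formalization: The time bound h(n) for solving Bar_C(A), uniform in the cutoff C (C = ∞ included), is assumed at least linear: h(n) ≥ b·n for some b > 0; otherwise the n distance evaluations per iteration of T can exceed the claimed O(n·h(n)). *)

(* Defs.v *)
From HB Require Import structures.
From mathcomp Require Import all_boot all_order all_algebra.
From mathcomp Require Import reals exp.

Set Implicit Arguments.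
Unset Strict Implicit.
Unset Printing Implicit Defensive.

Import Order.TTheory GRing.Theory Num.Theory.
Local Open Scope ring_scope.

(* An arbitrary metric on the set R^k; it need not induce the usual topology. *)
Record is_metric (R : realType) (T : Type) (d : T -> T -> R) : Prop := IsMetric {
  metric_ge0 : forall x y, 0 <= d x y;
  metric_eq0 : forall x y, d x y = 0 <-> x = y;
  metric_sym : forall x y, d x y = d y x;
  metric_triangle : forall x y z, d x z <= d x y + d y z }.

(* A cutoff is [Some C] with C a real number, or [None] for C = oo. *)
Definition objective (R : realType) (k : nat)
    (d : 'rV[R]_k -> 'rV[R]_k -> R) (q : R)
    (C : option R) (A : seq 'rV[R]_k) (x : 'rV[R]_k) : R :=
  \sum_(a <- A) (if C is Some c then Num.min (d x a `^ q) c else d x a `^ q).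

Definition optimal (R : realType) (k : nat)
    (d : 'rV[R]_k -> 'rV[R]_k -> R) (q : R)
    (C : option R) (A : seq 'rV[R]_k) (x : 'rV[R]_k) : Prop :=
  forall y, objective d q C A x <= objective d q C A y.

(* [v] is the minimum of the objective over R^k; for C = Some c this is the
   graph v = g(c), and it includes that the minimum is attained. *)
Definition is_min_value (R : realType) (k : nat)
    (d : 'rV[R]_k -> 'rV[R]_k -> R) (q : R)
    (C : option R) (A : seq 'rV[R]_k) (v : R) : Prop :=
  exists2 x, optimal d q C A x & v = objective d q C A x.

(* The first component is the number of steps spent. *)
Definition timed (X : Type) : Type := (nat * X)%type.

Definition bindT (X Y : Type) (m : timed X) (f : X -> timed Y) : timed Y :=
  let r := f m.2 in ((m.1 + r.1)%N, r.2).

Notation "x <~ m ;; f" := (bindT m (fun x => f))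
  (at level 100, m at next level, right associativity,
   format "'[v' x  <~  m ;; '/' f ']'").

(* Machine: a real RAM. [c_op] bounds the cost of one elementary operation
   (real or integer arithmetic, comparison, memory access, assignment, handling
   of a list cell or of a point of R^k) and [c_dist] the cost of one evaluation
   of d^q; k, d and q being fixed, both are constants. *)
Record unit_costs := UnitCosts { c_op : nat; c_dist : nat }.

Definition op (u : unit_costs) (X : Type) (m : nat) (x : X) : timed X :=
  ((m * c_op u)%N, x).

Fixpoint foldT (u : unit_costs) (X Y : Type) (f : Y -> X -> timed Y)
    (y : Y) (s : seq X) : timed Y :=
  if s is x :: s' then
    y' <~ f y x ;;
    y'' <~ op u 1 y' ;;
    foldT u f y'' s'
  else op u 1 y.

Fixpoint mapT (u : unit_costs) (X Y : Type) (f : X -> timed Y)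
    (s : seq X) : timed (seq Y) :=
  if s is x :: s' then
    y <~ f x ;;
    r <~ mapT u f s' ;;
    op u 1 (y :: r)
  else op u 1 [::].

Fixpoint filterT (u : unit_costs) (X : Type) (p : X -> timed bool)
    (s : seq X) : timed (seq X) :=
  if s is x :: s' then
    b <~ p x ;;
    r <~ filterT u p s' ;;
    op u 1 (if b then x :: r else r)
  else op u 1 [::].

Definition sizeT (u : unit_costs) (X : Type) (s : seq X) : timed nat :=
  foldT u (fun m _ => op u 1 m.+1) 0%N s.

(* Both return 0 on the empty list, on which they are never called. *)
Definition minT (u : unit_costs) (s : seq nat) : timed nat :=
  foldT u (fun m x => op u 1 (minn m x)) (head 0%N s) s.

Definition maxT (u : unit_costs) (s : seq nat) : timed nat :=
  foldT u (fun m x => op u 1 (maxn m x)) (head 0%N s) s.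

Definition solver (R : realType) (k : nat) : Type :=
  option R -> seq 'rV[R]_k -> timed ('rV[R]_k * R).

(* [bar] solves Bar_C(A) in at most h(|A|) steps, for every cutoff C in
   [0, oo], the problem without cutoff included. *)
Definition solves_within (R : realType) (k : nat)
    (d : 'rV[R]_k -> 'rV[R]_k -> R) (q : R)
    (bar : solver R k) (h : nat -> R) (A : seq 'rV[R]_k) : Prop :=
  forall C : option R, (if C is Some c then 0 <= c else true) ->
  let r := bar C A in
  [/\ optimal d q C A r.2.1,
      r.2.2 = objective d q C A r.2.1
    & (r.1)%:R <= h (size A)].

Definition activeT (R : realType) (k : nat)
    (d : 'rV[R]_k -> 'rV[R]_k -> R) (q : R) (u : unit_costs)
    (C : R) (A : seq 'rV[R]_k) (x : 'rV[R]_k) : timed (seq 'rV[R]_k) :=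
  filterT u (fun a => v <~ (c_dist u, d x a `^ q) ;; op u 1 (v <= C)) A.

(* [S_] and [O_] are lists without regard to order and repetitions. For i in
   [S_], [xi i] is the barycenter found for slope i and [pt i] is the point that
   determines l_i, so that (pt i).2 is the value Z_i. *)
Record state (R : realType) (k : nat) := State {
  S_ : seq nat;
  O_ : seq nat;
  xi : nat -> 'rV[R]_k;
  pt : nat -> R * R }.

(* Intersection of the line of slope i through p and the line of slope j
   through r. *)
Definition meetT (R : realType) (u : unit_costs) (i : nat) (p : R * R)
    (j : nat) (r : R * R) : timed (R * R) :=
  let C := ((p.2 - i%:R * p.1) - (r.2 - j%:R * r.1)) / (j%:R - i%:R) in
  op u 12 (C, p.2 + i%:R * (C - p.1)).

(* If n = 1 then the two slopes 0 and n - 1 coincide and the data of the latter,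
   which are assigned last, prevail. *)
Definition initT (R : realType) (k : nat) (u : unit_costs) (bar : solver R k)
    (a1 : 'rV[R]_k) (A : seq 'rV[R]_k) : timed (state R k) :=
  n <~ sizeT u A ;;
  b <~ bar None A ;;
  O0 <~ op u n (iota 1 (n - 2)) ;;
  op u 6 (State [:: 0%N; n.-1] O0
    [eta (fun=> a1) with n.-1 |-> a1, 0%N |-> b.1]
    [eta (fun=> (0, 0)) with n.-1 |-> (0, 0), 0%N |-> (0, b.2)]).

Definition bodyT (R : realType) (k : nat)
    (d : 'rV[R]_k -> 'rV[R]_k -> R) (q : R) (u : unit_costs)
    (bar : solver R k) (A : seq 'rV[R]_k) (st : state R k) :
    timed (state R k) :=
  n <~ sizeT u A ;;
  o <~ minT u (O_ st) ;;
  below <~ filterT u (fun s => op u 1 (s < o)%N) (S_ st) ;;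
  i <~ maxT u below ;;
  above <~ filterT u (fun s => op u 1 (o < s)%N) (S_ st) ;;
  j <~ minT u above ;;
  p <~ meetT u i (pt st i) j (pt st j) ;;
  b <~ bar (Some p.1) A ;;
  hit <~ op u 1 (b.2 == p.2) ;;
  if hit then
    O' <~ filterT u (fun s => op u 2 (~~ (i < s < j)%N)) (O_ st) ;;
    op u 1 (State (S_ st) O' (xi st) (pt st))
  else
    act <~ activeT d q u p.1 A b.1 ;;
    m <~ sizeT u act ;;
    s0 <~ op u 1 (n - m)%N ;;
    O' <~ filterT u (fun s => op u 1 (s != s0)) (O_ st) ;;
    op u 4 (State (s0 :: S_ st) O'
      [eta xi st with s0 |-> b.1] [eta pt st with s0 |-> (p.1, b.2)]).

(* One entry (i, (C_i, g(C_i)), xi_i) for each i in S. *)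
Definition output (R : realType) (k : nat) : Type :=
  seq (nat * (R * R) * 'rV[R]_k).

Definition finalT (R : realType) (k : nat) (u : unit_costs)
    (A : seq 'rV[R]_k) (st : state R k) : timed (output R k) :=
  n <~ sizeT u A ;;
  mapT u (fun i =>
    last_slope <~ op u 1 (i == n.-1) ;;
    if last_slope then op u 1 (i, (0, 0), xi st i)
    else
      above <~ filterT u (fun s => op u 1 (i < s)%N) (S_ st) ;;
      j <~ minT u above ;;
      p <~ meetT u i (pt st i) j (pt st j) ;;
      op u 1 (i, p, xi st i)) (S_ st).

(* [loop_runs .. st st' t]: started in [st], the while loop terminates in [st']
   after [t] steps. At most one pair (st', t) exists for each [st], so that
   existence of a run is total correctness. *)
Inductive loop_runs (R : realType) (k : nat)
    (d : 'rV[R]_k -> 'rV[R]_k -> R) (q : R) (u : unit_costs)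
    (bar : solver R k) (A : seq 'rV[R]_k) :
    state R k -> state R k -> nat -> Prop :=
| loop_stop st :
    O_ st = [::] -> loop_runs d q u bar A st st (c_op u)
| loop_step st st' t :
    O_ st <> [::] ->
    loop_runs d q u bar A (bodyT d q u bar A st).2 st' t ->
    loop_runs d q u bar A st st'
      (c_op u + (bodyT d q u bar A st).1 + t)%N.

(* [T_runs .. A out t]: the algorithm terminates on A = {a_1, ..., a_n}, n >= 1,
   after [t] steps and returns [out]. *)
Inductive T_runs (R : realType) (k : nat)
    (d : 'rV[R]_k -> 'rV[R]_k -> R) (q : R) (u : unit_costs)
    (bar : solver R k) : seq 'rV[R]_k -> output R k -> nat -> Prop :=
| T_run a1 A' st t :
    let A := a1 :: A' in
    loop_runs d q u bar A (initT u bar a1 A).2 st t ->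
    T_runs d q u bar A (finalT u A st).2
      ((initT u bar a1 A).1 + t + (finalT u A st).1)%N.

(* The piecewise linear function through p and the points of s, which are
   sorted by abscissa; it is constant after the last point. *)
Fixpoint interpolate (R : realType) (p : R * R) (s : seq (R * R)) (c : R) : R :=
  if s is r :: s' then
    if c < r.1 then p.2 + (r.2 - p.2) / (r.1 - p.1) * (c - p.1)
    else interpolate r s' c
  else p.2.

Definition output_fun (R : realType) (k : nat) (out : output R k) (c : R) : R :=
  if sort (fun p r : R * R => p.1 <= r.1) [seq e.1.2 | e <- out] is p :: s
  then interpolate p s c else 0.

(* The cutoff c lies between the point returned for the slope of e and the
   points returned for all smaller slopes, i.e. on the linear piece of g to
   which the barycenter of e corresponds. *)
Definition on_piece (R : realType) (k : nat) (out : output R k)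
    (e : nat * (R * R) * 'rV[R]_k) (c : R) : Prop :=
  [/\ e \in out, e.1.2.1 <= c
    & forall e', e' \in out -> (e'.1.1 < e.1.1)%N -> c <= e'.1.2.1].

Definition computes_g (R : realType) (k : nat)
    (d : 'rV[R]_k -> 'rV[R]_k -> R) (q : R) (A : seq 'rV[R]_k)
    (out : output R k) : Prop :=
  [/\ forall c, 0 <= c -> is_min_value d q (Some c) A (output_fun out c),
      forall e, e \in out ->
        0 <= e.1.2.1 /\ is_min_value d q (Some e.1.2.1) A e.1.2.2,
      forall c, 0 <= c -> exists e, on_piece out e c
    & forall c e, on_piece out e c -> optimal d q (Some c) A e.2].

(* Main.v *)
(* Each x gives C |-> f_C(x), which lies below the line of slope n - |active_C(x)|
   through its value at C; hence g has at every C >= 0 a supporting line of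
   integral slope. The lines found by the algorithm all touch g from above. If
   two of them with neighbouring slopes i < j meet above g, the supporting line
   at the meeting point has a slope strictly between i and j that is still open;
   if they meet on g, no slope strictly between them is needed. So each iteration
   removes an open slope, and there are at most n of them, each with one call of
   the solver and O(n) further steps. At the end all neighbouring lines meet on
   g, and on the piece between two meeting points g coincides with the line by
   concavity, so that the barycenter whose objective lies below that line is
   optimal there. *)
Require Import Defs.
From mathcomp Require Import all_boot all_order all_algebra.
From mathcomp Require Import reals exp.
From mathcomp Require Import ring lra zify.
Import Order.TTheory GRing.Theory Num.Theory.
Local Open Scope ring_scope.

Set Implicit Arguments.
Unset Strict Implicit.

Lemma size_filter_lt (T : eqType) (p : pred T) s x :
  x \in s -> ~~ p x -> (size (filter p s) < size s)%N.
Proof.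
move=> xs px; rewrite size_filter -(count_predC p s) -[ltnLHS]addn0 ltn_add2l.
by rewrite -has_count; apply/hasP; exists x.
Qed.

(** * Costs and values of the timed list operations *)

Section TimedOperations.

Variable u : unit_costs.
Implicit Types X Y : Type.

Lemma bindT_cost X Y (m : timed X) (f : X -> timed Y) :
  (bindT m f).1 = (m.1 + (f m.2).1)%N.
Proof. by []. Qed.

Lemma bindT_val X Y (m : timed X) (f : X -> timed Y) :
  (bindT m f).2 = (f m.2).2.
Proof. by []. Qed.

Lemma foldT_cost X Y (f : Y -> X -> timed Y) b y s :
  (forall y x, (f y x).1 = b) ->
  (foldT u f y s).1 = (size s * (b + c_op u) + c_op u)%N.
Proof.
move=> fb; elim: s y => [|x s IH] y /=; first by rewrite mul1n.
by rewrite IH fb /=; lia.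
Qed.

Lemma foldT_val X Y (f : Y -> X -> timed Y) y s :
  (foldT u f y s).2 = foldl (fun y x => (f y x).2) y s.
Proof. by elim: s y => //= x s IH y. Qed.

Lemma mapT_cost X Y (f : X -> timed Y) b s :
  (forall x, ((f x).1 <= b)%N) ->
  ((mapT u f s).1 <= size s * (b + c_op u) + c_op u)%N.
Proof.
move=> fb; elim: s => [|x s IH] /=; first by rewrite mul1n.
by have := fb x; lia.
Qed.

Lemma mapT_val X Y (f : X -> timed Y) s :
  (mapT u f s).2 = [seq (f x).2 | x <- s].
Proof. by elim: s => //= x s ->. Qed.

Lemma filterT_cost X (p : X -> timed bool) b s :
  (forall x, (p x).1 = b) ->
  (filterT u p s).1 = (size s * (b + c_op u) + c_op u)%N.
Proof.
move=> pb; elim: s => [|x s IH] /=; first by rewrite mul1n.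
by rewrite IH pb; lia.
Qed.

Lemma filterT_val X (p : X -> timed bool) s :
  (filterT u p s).2 = [seq x <- s | (p x).2].
Proof. by elim: s => //= x s ->. Qed.

Lemma sizeT_cost X (s : seq X) : (sizeT u s).1 = ((size s).*2 * c_op u + c_op u)%N.
Proof. by rewrite (@foldT_cost _ _ _ (c_op u)) => [|y x /=]; lia. Qed.

Lemma sizeT_val X (s : seq X) : (sizeT u s).2 = size s.
Proof.
rewrite foldT_val /=.
suff H m : foldl (fun y _ => y.+1) m s = (m + size s)%N by rewrite H.
by elim: s m => [|x s IH] m /=; rewrite ?addn0 // IH addSnnS.
Qed.

Lemma minT_cost s : (minT u s).1 = ((size s).*2 * c_op u + c_op u)%N.
Proof. by rewrite (@foldT_cost _ _ _ (c_op u)) => [|y x /=]; lia. Qed.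

Lemma maxT_cost s : (maxT u s).1 = ((size s).*2 * c_op u + c_op u)%N.
Proof. by rewrite (@foldT_cost _ _ _ (c_op u)) => [|y x /=]; lia. Qed.

Lemma minT_mem s : s != [::] -> (minT u s).2 \in s.
Proof.
rewrite foldT_val; case: s => //= x s _; rewrite minnn.
elim: s x => [|y s IH] x /=; first exact: mem_head.
have := IH (minn x y); rewrite !inE.
by case/orP => [/eqP ->|->]; rewrite ?orbT // /minn; case: ifP; rewrite eqxx ?orbT.
Qed.

Lemma minT_le s x : x \in s -> ((minT u s).2 <= x)%N.
Proof.
rewrite foldT_val; move: (head _ _) => /= m.
suff H : (foldl minn m s <= m)%N /\ (x \in s -> (foldl minn m s <= x)%N) by case: H.
elim: s m => [|y s IH] m //=; have [] := IH (minn m y); rewrite leq_min => /andP[? ?] Hs.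
by split=> //; rewrite inE => /orP[/eqP->|].
Qed.

Lemma maxT_mem s : s != [::] -> (maxT u s).2 \in s.
Proof.
rewrite foldT_val; case: s => //= x s _; rewrite maxnn.
elim: s x => [|y s IH] x /=; first exact: mem_head.
have := IH (maxn x y); rewrite !inE.
by case/orP => [/eqP ->|->]; rewrite ?orbT // /maxn; case: ifP; rewrite eqxx ?orbT.
Qed.

Lemma maxT_ge s x : x \in s -> (x <= (maxT u s).2)%N.
Proof.
rewrite foldT_val; move: (head _ _) => /= m.
suff H : (m <= foldl maxn m s)%N /\ (x \in s -> (x <= foldl maxn m s)%N) by case: H.
elim: s m => [|y s IH] m //=; have [] := IH (maxn m y); rewrite geq_max => /andP[? ?] Hs.
by split=> //; rewrite inE => /orP[/eqP->|].
Qed.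

End TimedOperations.

(** * Lines of integral slope and their meeting points *)

Section Lines.

Variable R : realType.
Implicit Types (g : R -> R) (p r : R * R) (c x y : R) (i j m : nat).

Definition line i p c : R := p.2 + i%:R * (c - p.1).

(** The point [p] only determines the line; the contact with [g] may lie elsewhere, as for the line
    of slope 0, which is given by its point over the cutoff 0. *)
Definition tangent g i p : Prop :=
  (forall c, 0 <= c -> g c <= line i p c) /\
  exists2 c, 0 <= c & g c = line i p c.

Definition meet (u : unit_costs) i p j r : R * R := (meetT u i p j r).2.

Lemma meet_line u i p j r : (meet u i p j r).2 = line i p (meet u i p j r).1.
Proof. by []. Qed.

Lemma line_diff u i p j r c : (i < j)%N ->
  line j r c = line i p c + (j%:R - i%:R) * (c - (meet u i p j r).1).
Proof.
move=> ij; have ji : j%:R - i%:R != 0 :> R.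
  by rewrite subr_eq0 eqr_nat neq_ltn ij orbT.
by rewrite /line /=; field.
Qed.

(** Where the steeper line touches [g] it is not above the flatter one, so this contact lies to the
    left of the meeting point; symmetrically, the flatter line touches to the right. *)
Lemma tangent_meet u g i p j r : (i < j)%N -> tangent g i p -> tangent g j r ->
  let z := meet u i p j r in
  [/\ 0 <= z.1, g z.1 <= z.2,
      exists2 x, 0 <= x <= z.1 & g x = line j r x
    & exists2 y, z.1 <= y & g y = line i p y].
Proof.
move=> ij [pU [y y0 gy]] [rU [x x0 gx]] z.
have ji : 0 < j%:R - i%:R :> R by rewrite subr_gt0 ltr_nat.
have xz : x <= z.1.
  have := pU x x0; rewrite gx (line_diff u p r x ij) gerDl pmulr_rle0 //.
  by rewrite subr_le0.
have zy : z.1 <= y.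
  have := rU y y0; rewrite gy (line_diff u p r y ij) lerDl pmulr_rge0 //.
  by rewrite subr_ge0.
have z0 := le_trans x0 xz.
split=> //; first by rewrite meet_line; apply: pU.
  by exists x; rewrite ?x0.
by exists y.
Qed.

(** The supporting line starts strictly below the meeting point but must reach both lines again at
    their contacts. The contact on the right excludes [m <= i], the one on the left excludes
    [j <= m]. *)
Lemma slope_between u g i p j r m : (i < j)%N ->
  tangent g i p -> tangent g j r ->
  let z := meet u i p j r in g z.1 != z.2 ->
  (forall c, 0 <= c -> g c <= g z.1 + m%:R * (c - z.1)) -> (i < m < j)%N.
Proof.
move=> ij tp tr z gz mU.
have [z0 zle [x /andP[x0 xz] gx] [y zy gy]] := tangent_meet u ij tp tr.
have zlt : g z.1 < z.2 by rewrite lt_neqAle gz.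
have y0 := le_trans z0 zy.
have yL : line i p y = z.2 + i%:R * (y - z.1) by rewrite meet_line /line; ring.
have xL : line j r x = z.2 + j%:R * (x - z.1).
  by rewrite meet_line (line_diff u p r x ij) /line; ring.
move: mU zlt z0 zy xz yL xL; rewrite -/z; clearbody z => mU zlt z0 zy xz yL xL.
have := mU y y0; rewrite gy yL; have := mU x x0; rewrite gx xL => Hx Hy.
apply/andP; split; rewrite ltnNge; apply/negP; rewrite -(ler_nat R) => H.
  by have := ler_wpM2r (_ : 0 <= y - z.1) H; rewrite subr_ge0 => /(_ zy); lra.
by have := ler_wpM2r (_ : 0 <= z.1 - x) H; rewrite subr_ge0 => /(_ xz); lra.
Qed.

End Lines.

(** * Recovering a function from sorted points on its graph *)

(** The conditions on [g] speak of membership and abscissae, not of positions, so they can be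
    checked without knowing the order produced by sorting, and repeated abscissae do no harm. *)
Lemma interpolate_eq (R : realType) (g : R -> R) (p : R * R) (s : seq (R * R)) c :
  let L := p :: s in
  (forall a b x, a \in L -> b \in L ->
     (forall r, r \in L -> r.1 <= a.1 \/ b.1 <= r.1) -> a.1 <= x < b.1 ->
     g x = a.2 + (b.2 - a.2) / (b.1 - a.1) * (x - a.1)) ->
  (forall a x, a \in L -> (forall r, r \in L -> r.1 <= a.1) -> a.1 <= x ->
     g x = a.2) ->
  path (fun a b : R * R => a.1 <= b.1) p s -> p.1 <= c ->
  interpolate p s c = g c.
Proof.
have tr : transitive (fun a b : R * R => a.1 <= b.1).
  by move=> a b e /= ba; apply: le_trans.
elim: s p => [|r s IH] p /= gap tail.
  move=> _ pc; rewrite (tail p) ?mem_head // => a; rewrite inE => /eqP->.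
  exact: lexx.
move=> /andP[pr rs] pc.
have rmin : forall a, a \in r :: s -> r.1 <= a.1.
  move=> a; rewrite inE => /orP[/eqP->|]; first exact: lexx.
  by move/(order_path_min tr): rs => /allP; apply.
case: ifPn => cr.
  rewrite (gap p r) ?mem_head ?inE ?eqxx ?orbT ?pc //.
  by move=> a; rewrite inE => /orP[/eqP->|/rmin]; [left|right].
apply: IH => //; last by rewrite leNgt.
- move=> a b x aL bL ab; apply: gap; rewrite 1?inE ?aL ?bL ?orbT //.
  move=> e; rewrite inE => /orP[/eqP->|/ab //].
  by left; apply: le_trans pr (rmin _ aL).
- move=> a x aL amax; apply: tail; first by rewrite inE aL orbT.
  move=> e; rewrite inE => /orP[/eqP->|/amax //].
  exact: le_trans pr (rmin _ aL).
Qed.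

(** * Gaps between neighbouring slopes *)

Definition consecutive (S : seq nat) (i j : nat) : Prop :=
  [/\ i \in S, j \in S, (i < j)%N & forall s, s \in S -> (s <= i)%N \/ (j <= s)%N].

Lemma consecutive_uniq (S : seq nat) i j i' j' k :
  consecutive S i j -> consecutive S i' j' ->
  (i < k < j)%N -> (i' < k < j')%N -> i = i' /\ j = j'.
Proof.
move=> [iS jS ij H] [iS' jS' ij' H'] k1 k2.
have [] := (H _ iS', H _ jS'); have [] := (H' _ iS, H' _ jS).
lia.
Qed.

(** A new slope splits only the gap that contains it. In the last alternative both ends differ from
    [s0], so their lines survive the update of the state. *)
Lemma consecutive_insert (S : seq nat) i j s0 i' j' m :
  consecutive S i j -> (i < s0 < j)%N -> consecutive (s0 :: S) i' j' ->
  (i' < m < j')%N ->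
  m != s0 /\ ((i < m < j)%N \/ [/\ consecutive S i' j', i' != s0 & j' != s0]).
Proof.
move=> [iS jS _ _] is0j [iS' jS' ij' H'] imj'.
have Hi : (i <= i')%N \/ (j' <= i)%N by apply: H'; rewrite inE iS orbT.
have Hj : (j <= i')%N \/ (j' <= j)%N by apply: H'; rewrite inE jS orbT.
have H0 : (s0 <= i')%N \/ (j' <= s0)%N by apply: H'; exact: mem_head.
split; first by clear -H0 imj'; lia.
have [imj|imj] := boolP (i < m < j)%N; [by left|right].
have ni : i' != s0 by clear -Hi Hj is0j imj imj'; lia.
have nj : j' != s0 by clear -Hi Hj is0j imj imj'; lia.
move: iS' jS'; rewrite !inE (negPf ni) (negPf nj) => iS' jS'.
by split=> //; split=> // s sS; apply: H'; rewrite inE sS orbT.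
Qed.

(** Defined by the search that the algorithm performs, so that its steps evaluate to it directly;
    meaningful only if [S] has a larger element. *)
Definition successor (u : unit_costs) (S : seq nat) (i : nat) : nat :=
  (minT u [seq s <- S | (i < s)%N]).2.

Definition predecessor (u : unit_costs) (S : seq nat) (i : nat) : nat :=
  (maxT u [seq s <- S | (s < i)%N]).2.

Lemma successorP u S i : (exists2 s, s \in S & (i < s)%N) ->
  [/\ successor u S i \in S, (i < successor u S i)%N
    & forall s, s \in S -> (i < s)%N -> (successor u S i <= s)%N].
Proof.
move=> [s sS si]; have : s \in [seq s <- S | (i < s)%N] by rewrite mem_filter si.
rewrite /successor; set T := [seq _ <- S | _] => sT.
have : T != [::] by case: (T) sT.
move=> /(minT_mem u); rewrite mem_filter => /andP[-> ->]; split=> // t tS it.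
by apply: minT_le; rewrite mem_filter it.
Qed.

Lemma predecessorP u S i : (exists2 s, s \in S & (s < i)%N) ->
  [/\ predecessor u S i \in S, (predecessor u S i < i)%N
    & forall s, s \in S -> (s < i)%N -> (s <= predecessor u S i)%N].
Proof.
move=> [s sS si]; have : s \in [seq s <- S | (s < i)%N] by rewrite mem_filter si.
rewrite /predecessor; set T := [seq _ <- S | _] => sT.
have : T != [::] by case: (T) sT.
move=> /(maxT_mem u); rewrite mem_filter => /andP[-> ->]; split=> // t tS it.
by apply: maxT_ge; rewrite mem_filter it.
Qed.

(** * Tangent systems whose neighbouring lines all meet on the graph *)

Record tangent_system (R : realType) (g : R -> R) (N : nat)
    (S : seq nat) (pt : nat -> R * R) : Prop := TangentSystem {
  slope0_in : 0%N \in S;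
  slopeN_in : N \in S;
  slope_le : forall s, s \in S -> (s <= N)%N;
  ptN : pt N = (0, 0);
  tangent_in : forall s, s \in S -> tangent g s (pt s) }.

Section CompleteSystem.

Variables (R : realType) (u : unit_costs) (g : R -> R) (N : nat).
Variables (S : seq nat) (pt : nat -> R * R).
Hypothesis g_support : forall c, 0 <= c ->
  exists m : nat, forall x, 0 <= x -> g x <= g c + m%:R * (x - c).
Hypothesis g0 : g 0 = 0.
Hypothesis sysS : tangent_system g N S pt.
Hypothesis meet_on_g : forall i j, consecutive S i j ->
  let z := meet u i (pt i) j (pt j) in g z.1 = z.2.

(** The left end of the piece of slope [i]: by concavity the next larger slope takes over to its
    left. The steepest piece starts at the origin. *)
Definition kink i : R * R :=
  if i == N then (0, 0)
  else meet u i (pt i) (successor u S i) (pt (successor u S i)).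

Lemma kinkP i : i \in S ->
  [/\ 0 <= (kink i).1, g (kink i).1 = (kink i).2
    & (kink i).2 = line i (pt i) (kink i).1].
Proof.
move=> iS; rewrite /kink; case: eqVneq => [->|iN].
  by rewrite (ptN sysS) /line /=; split; rewrite ?g0 // subrr mulr0 addr0.
have [|jS ij jmin] := @successorP u S i.
  exists N; first exact: slopeN_in sysS.
  by rewrite ltn_neqAle iN (slope_le sysS).
set j := successor u S i in jS ij jmin *.
have cij : consecutive S i j by split=> // s sS; have := jmin s sS; lia.
have [z0 _ _ _] := tangent_meet u ij (tangent_in sysS iS) (tangent_in sysS jS).
by split; [|exact: meet_on_g|exact: meet_line].
Qed.

(** The successor of the predecessor of [i] is [i] again, so the predecessor's kink is also on the
    line of [i]: it is the right end of that piece. *)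
Lemma kink_pred i : i \in S -> (0 < i)%N -> exists2 i', i' \in S /\ (i' < i)%N &
  (kink i').2 = line i (pt i) (kink i').1.
Proof.
move=> iS i0; have [|jS ji jmax] := @predecessorP u S i.
  by exists 0%N; rewrite ?(slope0_in sysS).
set j := predecessor u S i in jS ji jmax.
exists j => //; have jN : j == N = false by have := slope_le sysS iS; lia.
have [|sS js smin] := @successorP u S j; first by exists i.
have sE : successor u S j = i.
  by have := smin i iS ji; have := jmax _ sS; lia.
by rewrite /kink jN sE meet_line (line_diff u (pt j) (pt i) _ ji) subrr mulr0 addr0.
Qed.

(* Between two points of contact of a line [g] cannot lie below it, since the
   supporting line of [g] in between does not. *)
Lemma piece_line i c : i \in S -> (kink i).1 <= c ->
  (forall i', i' \in S -> (i' < i)%N -> c <= (kink i').1) ->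
  g c = line i (pt i) c.
Proof.
move=> iS kc ck; have [k0 gk kl] := kinkP iS.
have c0 := le_trans k0 kc.
apply/eqP; rewrite eq_le (tangent_in sysS iS).1 //=.
have [m mU] := g_support c0.
have := mU _ k0; rewrite gk kl.
(* Slope 0 has no right end, but there the left end suffices: the line is constant and the
   supporting slope [m] is nonnegative. *)
case: (posnP i) => [i0|i0].
  rewrite i0 /line !mul0r !addr0 => H; apply: le_trans H _.
  by rewrite gerDl mulr_ge0_le0 // subr_le0 -i0.
have [j [jS ji] jl] := kink_pred iS i0.
have cj := ck _ jS ji; have [j0 gj _] := kinkP jS.
have := mU _ j0; rewrite gj jl /line.
move: (kink i).1 (kink j).1 kc cj => a b ac cb {mU k0 gk kl j0 gj jl ck}.
(* If [m] is at most [i], the bound at the right end [b] gives the claim, otherwise the bound at the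
   left end [a]. *)
have [mi|im] := leP (m%:R : R) i%:R => H1 H2.
  by have := ler_wpM2r (_ : 0 <= b - c) mi; rewrite subr_ge0 => /(_ cb); lra.
by have := ler_wpM2r (_ : 0 <= c - a) (ltW im); rewrite subr_ge0 => /(_ ac); lra.
Qed.

(** Take the smallest slope whose kink is not to the right of [c]; [N] is a candidate because its
    kink is the origin. *)
Lemma piece_exists c : 0 <= c -> exists i, [/\ i \in S, (kink i).1 <= c &
  forall i', i' \in S -> (i' < i)%N -> c <= (kink i').1].
Proof.
move=> c0; have exi : exists i, (i \in S) && ((kink i).1 <= c).
  by exists N; rewrite (slopeN_in sysS) /kink eqxx.
case: (ex_minnP exi) => i /andP[iS kc] imin; exists i; split=> // j jS ji.
by rewrite leNgt; apply/negP => cj; have := imin j; rewrite jS (ltW cj) leqNgt ji => /(_ isT).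
Qed.

Lemma interpolate_kinks c : 0 <= c ->
  (if sort (fun p r : R * R => p.1 <= r.1) (map kink S) is p :: s
   then interpolate p s c else 0) = g c.
Proof.
move=> c0; set le1 := fun p r : R * R => p.1 <= r.1.
have mem_L : sort le1 (map kink S) =i map kink S := mem_sort _ _.
have srt : sorted le1 (sort le1 (map kink S)).
  by apply: sort_sorted => a b; exact: le_total.
have tr : transitive le1 by move=> a b e /= ba; apply: le_trans.
have inL i : i \in S -> kink i \in sort le1 (map kink S).
  by move=> iS; rewrite mem_L map_f.
have Lkink r : r \in sort le1 (map kink S) -> exists2 i, i \in S & r = kink i.
  by rewrite mem_L => /mapP.
case: (sort _ _) srt inL Lkink => [|p s] /= ps inL Lkink.
  by have := inL N (slopeN_in sysS).
have head_min r : r \in p :: s -> p.1 <= r.1.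
  rewrite inE => /orP[/eqP->|]; first exact: lexx.
  by move/(order_path_min tr): ps => /allP; apply.
apply: interpolate_eq => //; last first.
- by have := head_min _ (inL N (slopeN_in sysS)); rewrite /kink eqxx => /le_trans; apply.
- move=> a x /Lkink[e eS ->] amax ax.
  have [e0 ge _] := kinkP eS.
  (* Strictly to the right of the last kink, the piece containing [x] has slope 0: otherwise [x]
     would be at most the kink of slope 0. *)
  have [->|xa] := eqVneq x (kink e).1; first by [].
  have {}ax : (kink e).1 < x by rewrite lt_neqAle eq_sym xa.
  have [i [iS kx xk]] := piece_exists (le_trans e0 (ltW ax)).
  have i0 : i = 0%N.
    apply/eqP; rewrite -leqn0 leqNgt; apply/negP => /(xk _ (slope0_in sysS)).
    by move/(lt_le_trans ax); rewrite ltNge amax // inL // (slope0_in sysS).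
  rewrite (piece_line iS kx xk) -ge (@piece_line i) //; first by rewrite i0 /line !mul0r.
    by apply: amax; exact: inL.
  by rewrite i0.
move=> a b x /Lkink[ea aS ->] /Lkink[eb bS ->] ab /andP[ax xb].
have [a0 ga _] := kinkP aS; have [b0 gb _] := kinkP bS.
have [->|xa] := eqVneq x (kink ea).1; first by rewrite subrr mulr0 addr0.
have {}ax : (kink ea).1 < x by rewrite lt_neqAle eq_sym xa.
(* No kink lies strictly between the two given ones, so the piece containing [x] reaches from one to
   the other, and [g] follows a single line there. *)
have [i [iS kx xk]] := piece_exists (le_trans a0 (ltW ax)).
have ia : (kink i).1 <= (kink ea).1.
  by case: (ab _ (inL _ iS)) => // /(lt_le_trans xb); rewrite ltNge kx.
have ib i' : i' \in S -> (i' < i)%N -> (kink eb).1 <= (kink i').1.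
  move=> iS' ii'; case: (ab _ (inL _ iS')) => // H.
  by have := le_lt_trans (le_trans (xk _ iS' ii') H) ax; rewrite ltxx.
have ab1 := lt_trans ax xb.
rewrite -ga -gb (piece_line iS kx xk).
rewrite (@piece_line i (kink ea).1) // => [|i' iS' ii']; last first.
  exact: le_trans (ltW ab1) (ib _ iS' ii').
rewrite (@piece_line i (kink eb).1) //; last exact: le_trans ia (ltW ab1).
rewrite /line; field.
by rewrite subr_eq0 gt_eqF.
Qed.

End CompleteSystem.

(** * The objective at a fixed point as a function of the cutoff *)

Section Objective.

Variables (R : realType) (k : nat) (d : 'rV[R]_k -> 'rV[R]_k -> R) (q : R).
Implicit Types (A : seq 'rV[R]_k) (x : 'rV[R]_k) (c : R).

Lemma objective_ge0 c A x : 0 <= c -> 0 <= objective d q (Some c) A x.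
Proof.
by move=> c0; apply: sumr_ge0 => a _; rewrite le_min powR_ge0.
Qed.

Lemma objective_cutoff_le c A x :
  objective d q (Some c) A x <= objective d q None A x.
Proof. by apply: ler_sum => a _; rewrite ge_min lexx. Qed.

Lemma objective_cutoff0 A x : objective d q (Some 0) A x = 0.
Proof. by apply: big1 => a _; apply/min_idPr; exact: powR_ge0. Qed.

(** Term by term, on either side of [c]: an active point contributes at most its full distance term,
    which it already contributes at [c]; any other contributes [c] at cutoff [c] and at most [c'] at
    cutoff [c']. *)
Lemma objective_support c c' A x :
  let m := size [seq a <- A | d x a `^ q <= c] in
  objective d q (Some c') A x <=
    objective d q (Some c) A x + (size A - m)%:R * (c' - c).
Proof.
rewrite /= size_filter -(count_predC (fun a => d x a `^ q <= c)) addKn /objective.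
elim: A => [|a A IH]; first by rewrite !big_nil mul0r addr0.
rewrite !big_cons /= natrD mulrDl addrACA; apply: lerD IH.
case: (leP (d x a `^ q) c) => vc /=.
  by rewrite mul0r addr0 ge_min lexx.
by rewrite mul1r addrC subrK ge_min lexx orbT.
Qed.

Lemma objective_at_input c a1 A : d a1 a1 = 0 -> q != 0 -> 0 <= c ->
  objective d q (Some c) (a1 :: A) a1 <= (size A)%:R * c.
Proof.
move=> d0 q0 c0; rewrite /objective big_cons d0 powR0 // (min_idPl c0) add0r.
rewrite -sum1_size natr_sum mulr_suml; apply: ler_sum => a _.
by rewrite mul1r ge_min lexx orbT.
Qed.

(** Either no term exceeds the cutoff, or one term equals [c] and the others are nonnegative. This
    provides a contact point for the line of slope 0. *)
Lemma objective_cutoff_or c A x : 0 <= c ->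
  objective d q None A x <= objective d q (Some c) A x \/
  c <= objective d q (Some c) A x.
Proof.
move=> c0; elim: A => [|a A IH]; first by left; rewrite /objective !big_nil.
have F0 : 0 <= objective d q (Some c) A x by exact: objective_ge0.
move: IH F0; rewrite /objective !big_cons => IH F0.
have v0 : 0 <= d x a `^ q := powR_ge0 _ _.
case: (leP (d x a `^ q) c) => vc.
  by case: IH => H; [left; rewrite lerD2l | right; rewrite -[leLHS]add0r lerD].
by right; rewrite lerDl.
Qed.

End Objective.

(** * Effect and cost of one round of the loop *)

Section Iteration.

Variables (R : realType) (k : nat) (d : 'rV[R]_k -> 'rV[R]_k -> R) (q : R).
Variables (u : unit_costs) (bar : solver R k) (A : seq 'rV[R]_k).

(** For a correct solver and [c >= 0] this is the value of $g$ at [c], so the solver itself supplies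
    $g$ as a function. *)
Definition opt_value (c : R) : R := (bar (Some c) A).2.2.

Definition new_slope (c : R) : nat :=
  (size A - size [seq a <- A | d (bar (Some c) A).2.1 a `^ q <= c]%R)%N.

Definition lower_slope (st : state R k) : nat :=
  predecessor u (S_ st) (minT u (O_ st)).2.

Definition upper_slope (st : state R k) : nat :=
  successor u (S_ st) (minT u (O_ st)).2.

Definition next_point (st : state R k) : R * R :=
  let i := lower_slope st in let j := upper_slope st in
  meet u i (pt st i) j (pt st j).

Lemma bodyT_val st :
  let z := next_point st in
  (bodyT d q u bar A st).2 =
    if opt_value z.1 == z.2 then
      State (S_ st)
        [seq s <- O_ st | ~~ (lower_slope st < s < upper_slope st)%N]
        (xi st) (pt st)
    else
      let s0 := new_slope z.1 in
      State (s0 :: S_ st) [seq s <- O_ st | s != s0]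
        [eta xi st with s0 |-> (bar (Some z.1) A).2.1]
        [eta pt st with s0 |-> (z.1, opt_value z.1)].
Proof.
move=> z; rewrite /bodyT !bindT_val !filterT_val sizeT_val.
rewrite -[(maxT _ _).2]/(lower_slope st).
rewrite -[(minT _ [seq _ <- S_ st | _]).2]/(upper_slope st).
rewrite -[(meetT _ _ _ _ _).2]/z -[(op u 1 _).2]/(opt_value z.1 == z.2).
case: ifP => _; rewrite !bindT_val filterT_val //.
by rewrite sizeT_val /activeT filterT_val.
Qed.

Lemma bodyT_cost st : (0 < size A)%N ->
  (size (S_ st) + size (O_ st) <= (size A).+1)%N ->
  (c_op u + (bodyT d q u bar A st).1 <=
     (bar (Some (next_point st).1) A).1 +
     100 * (size A * (c_op u + c_dist u)))%N.
Proof.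
move=> A0 sizeSO.
have fle (T : Type) (p : pred T) s : (size (filter p s) <= size s)%N.
  by rewrite size_filter count_size.
have fc (T : Type) (p : T -> timed bool) s b : (forall x, (p x).1 = (b * c_op u)%N) ->
    (filterT u p s).1 = (size s * (b * c_op u + c_op u) + c_op u)%N.
  exact: filterT_cost.
set z := next_point st.
rewrite /bodyT !bindT_cost !filterT_val (fc _ _ _ 1%N) // (fc _ _ _ 1%N) //.
rewrite -[(maxT _ _).2]/(lower_slope st).
rewrite -[(minT _ [seq _ <- S_ st | _]).2]/(upper_slope st).
rewrite -[(meetT _ _ _ _ _).2]/z.
rewrite sizeT_cost !minT_cost !maxT_cost.
(* The products of list lengths with [c_op u] are bounded one by one, which leaves linear goals for
   [lia]. *)
have leM a : (a <= (size A).*2 -> a * c_op u <= (size A).*2 * c_op u)%N.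
  by move=> aA; rewrite leq_mul2r aA orbT.
have SA := leM (size (S_ st)) ltac:(lia); have OA := leM (size (O_ st)) ltac:(lia).
have SfA p : (size (filter p (S_ st)) * c_op u <= (size A).*2 * c_op u)%N.
  by apply: leM; have := fle _ p (S_ st); lia.
have OfA p : (size (filter p (O_ st)) * c_op u <= (size A).*2 * c_op u)%N.
  by apply: leM; have := fle _ p (O_ st); lia.
have AfA p : (size (filter p A) * c_op u <= (size A).*2 * c_op u)%N.
  by apply: leM; have := fle _ p A; lia.
have A1 : (1 * c_op u <= size A * c_op u)%N by rewrite leq_mul2r A0 orbT.
set below := [seq x <- S_ st | _]; have := SfA _ : (size below * _ <= _)%N.
set above := [seq x <- S_ st | _]; have := SfA _ : (size above * _ <= _)%N.
move: (size below) (size above) => b1 b2 h1 h2.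
move: (bar _ A).1 => cb.
case: ifP => _; rewrite !bindT_cost.
  rewrite (fc _ _ _ 2%N) //=; lia.
rewrite (fc _ _ _ 1%N) // /activeT (@filterT_cost u _ _ (c_dist u + c_op u)%N); last first.
  by move=> a; rewrite /= mul1n.
rewrite sizeT_cost filterT_val.
set act := filter _ _; have := AfA _ : (size act * _ <= _)%N.
move: (size act) => b3 h3 /=; lia.
Qed.

End Iteration.

(** * Invariant, termination and correctness of the algorithm *)

Section Algorithm.

Variables (R : realType) (k : nat) (d : 'rV[R]_k -> 'rV[R]_k -> R) (q : R).
Variables (u : unit_costs) (bar : solver R k) (h : nat -> R).
Variables (a1 : 'rV[R]_k) (A' : seq 'rV[R]_k).
Let A := a1 :: A'.
Let n := size A.
Hypothesis bar_solves : solves_within d q bar h A.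

Let w := (c_op u + c_dist u)%N.
Let g := opt_value bar A.

Lemma barP c : 0 <= c ->
  [/\ g c = objective d q (Some c) A (bar (Some c) A).2.1,
      forall y, g c <= objective d q (Some c) A y
    & ((bar (Some c) A).1)%:R <= h n].
Proof.
move=> c0; have [opt vE cost] := bar_solves (C := Some c) c0.
by split=> // y; rewrite /g /opt_value vE.
Qed.

Lemma g_is_min c : 0 <= c -> is_min_value d q (Some c) A (g c).
Proof.
move=> c0; have [opt vE _] := bar_solves (C := Some c) c0.
by exists (bar (Some c) A).2.1.
Qed.

Lemma g_support c x : 0 <= c -> 0 <= x ->
  objective d q (Some x) A (bar (Some c) A).2.1 <=
    g c + (new_slope d q bar A c)%:R * (x - c).
Proof. by move=> c0 x0; have [-> _ _] := barP c0; exact: objective_support. Qed.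

Lemma g_support_ex c : 0 <= c ->
  exists m : nat, forall x, 0 <= x -> g x <= g c + m%:R * (x - c).
Proof.
move=> c0; exists (new_slope d q bar A c) => x x0; apply: le_trans (g_support c0 x0).
by have [_ + _] := barP x0; apply.
Qed.

Lemma g0 : g 0 = 0.
Proof. by have [-> _ _] := barP (lexx 0); rewrite objective_cutoff0. Qed.

(* A slope between two neighbours is dropped only if their lines meet on the
   graph of [g], and then no later slope falls between them. *)
Record invariant (st : state R k) : Prop := Invariant {
  inv_sys : tangent_system g n.-1 (S_ st) (pt st);
  inv_xi : forall s c, s \in S_ st -> 0 <= c ->
    objective d q (Some c) A (xi st s) <= line s (pt st s) c;
  inv_open : forall o, o \in O_ st -> (0 < o < n.-1)%N /\ o \notin S_ st;
  inv_gap : forall i j m, consecutive (S_ st) i j -> (i < m < j)%N ->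
    m \in O_ st \/
    (let z := meet u i (pt st i) j (pt st j) in g z.1 = z.2);
  inv_size : (size (S_ st) + size (O_ st) <= n.+1)%N }.

(* A supporting line at a meeting point off the graph of [g] would have an
   integral slope strictly between [i] and [j], which would still be open. *)
Lemma complete_meet st i j : invariant st -> O_ st = [::] ->
  consecutive (S_ st) i j ->
  let z := meet u i (pt st i) j (pt st j) in g z.1 = z.2.
Proof.
move=> I O0 cij z; have [iS jS ij nij] := cij.
have tE s sS := tangent_in (inv_sys I) (s := s) sS.
apply/eqP/negPn/negP => gz.
have [z0 _ _ _] := tangent_meet u ij (tE i iS) (tE j jS).
have [m mU] := g_support_ex z0.
have := slope_between ij (tE i iS) (tE j jS) gz mU.
by move=> /(inv_gap I cij); rewrite O0 => -[|/eqP] //; apply/negP.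
Qed.

Lemma initT_val : (initT u bar a1 A).2 =
  let b := (bar None A).2 in
  State [:: 0%N; n.-1] (iota 1 (n - 2))
    [eta (fun=> a1) with n.-1 |-> a1, 0%N |-> b.1]
    [eta (fun=> (0, 0)) with n.-1 |-> (0, 0), 0%N |-> (0, b.2)].
Proof.
by rewrite /initT; have := sizeT_val u A; case: (sizeT u A) => t m /= ->.
Qed.

Lemma initT_invariant : d a1 a1 = 0 -> q != 0 -> invariant (initT u bar a1 A).2.
Proof.
move=> d0 q0.
rewrite initT_val.
have [opt vE _] := bar_solves (C := None) isT.
have g_le c y : 0 <= c -> g c <= objective d q (Some c) A y.
  by case/barP.
have Z0 : 0 <= (bar None A).2.2.
  by rewrite vE; apply: le_trans (objective_cutoff_le d q 0 _ _) ; rewrite objective_cutoff0.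
have gN c : 0 <= c -> g c <= n.-1%:R * c.
  by move=> c0; apply: (le_trans (g_le _ a1 c0)); exact: objective_at_input.
have tN : tangent g n.-1 (0, 0).
  split=> [c c0|]; first by rewrite /line add0r subr0; exact: gN.
  by exists 0; rewrite ?g0 // /line subrr mulr0 addr0.
have tO : tangent g 0 (0, (bar None A).2.2).
  split=> [c c0|].
    rewrite /line mul0r addr0 vE; apply: le_trans (objective_cutoff_le d q c _ _).
    exact: g_le.
  (* The contact is at the cutoff equal to the optimal value without cutoff: there an optimal point
     either has no truncated term or has one term that alone costs this much. *)
  exists (bar None A).2.2 => //; have [gE gle _] := barP Z0.
  apply/eqP; rewrite eq_le /line mul0r addr0 /=; apply/andP; split.
    by rewrite {2}vE; apply: le_trans (objective_cutoff_le d q _ _ _); exact: gle.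
  rewrite gE; set x := (bar (Some _) A).2.1.
  have [H|//] := objective_cutoff_or d q A x Z0.
  by apply: le_trans _ H; rewrite vE; exact: opt.
split=> /=.
- split=> /=.
  + exact: mem_head.
  + by rewrite !inE eqxx orbT.
  + by move=> s; rewrite !inE => /orP[] /eqP->.
  + by rewrite eqxx.
  (* The slope [n.-1] is tested first, since for n = 1 it coincides with 0 and its data prevail. *)
  + move=> s; rewrite !inE; case: (eqVneq s n.-1) => [->|_]; first by [].
    by rewrite orbF => /eqP->.
- move=> s c; rewrite !inE; case: (eqVneq s n.-1) => [->|_].
    by move=> _ c0; rewrite /line add0r subr0; exact: objective_at_input.
  rewrite orbF => /eqP-> c0 /=; rewrite /line mul0r addr0 vE.
  exact: objective_cutoff_le.
- move=> o; rewrite mem_iota !inE -/n => H.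
  rewrite /n /A /= in H *.
  by split; [lia | apply/negP => /orP[] /eqP; lia].
- move=> i j m [_ + _ _] imj; rewrite !inE => Hj; left.
  by rewrite mem_iota; case/orP: Hj => /eqP; rewrite /n /A /= in imj *; lia.
- by rewrite size_iota /n /A /=; lia.
Qed.

Lemma initT_cost :
  ((initT u bar a1 A).1)%:R <= h n + (10 * (n * w))%:R.
Proof.
have [_ _ cost] := bar_solves (C := None) isT.
apply: le_trans (lerD cost (lexx _)); rewrite -natrD ler_nat.
rewrite /initT bindT_cost sizeT_cost sizeT_val -/n !bindT_cost /= /w.
have : (1 * c_op u <= n * c_op u)%N by rewrite leq_mul2r orbT.
by move: (bar None A).1 => ?; lia.
Qed.

(** Open slopes lie strictly between the slopes 0 and [n.-1] of [S_], so both searches run on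
    nonempty lists. *)
Lemma lower_upperP st : invariant st -> O_ st <> [::] ->
  let i := lower_slope u st in let j := upper_slope u st in
  let o := (minT u (O_ st)).2 in
  [/\ consecutive (S_ st) i j, o \in O_ st & (i < o < j)%N].
Proof.
move=> I /eqP On i j o; have oO : o \in O_ st := minT_mem u On.
have [/andP[o0 oN] oS] := inv_open I oO.
have [|iS io imax] := @predecessorP u (S_ st) o.
  by exists 0%N => //; exact: slope0_in (inv_sys I).
have [|jS oj jmin] := @successorP u (S_ st) o.
  by exists n.-1 => //; exact: slopeN_in (inv_sys I).
rewrite -/(lower_slope u st) -/i in iS io imax.
rewrite -/(upper_slope u st) -/j in jS oj jmin.
split; rewrite ?io //; split=> // [|s sS]; first exact: ltn_trans oj.
have [so|os|so] := ltngtP s o; [left|right|]; [exact: imax|exact: jmin|].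
by rewrite -so sS in oS.
Qed.

(** On a hit, only slopes in a gap whose lines meet on [g] are dropped, among them [o]. Otherwise
    the new slope was open in the gap and moves from [O_] to [S_]. *)
Lemma bodyT_step st : invariant st -> O_ st <> [::] ->
  let st' := (bodyT d q u bar A st).2 in
  [/\ invariant st', (size (O_ st') < size (O_ st))%N
    & (c_op u + (bodyT d q u bar A st).1)%:R <= h n + (100 * (n * w))%:R].
Proof.
move=> I On st'; have [cij oO ioj] := lower_upperP I On.
set i := lower_slope u st in cij ioj; set j := upper_slope u st in cij ioj.
set o := (minT u (O_ st)).2 in oO ioj.
have [iS jS ij _] := cij.
have tE s sS := tangent_in (inv_sys I) (s := s) sS.
pose z := next_point u st.
have [z0 _ _ _] := tangent_meet u ij (tE i iS) (tE j jS).
rewrite -[meet _ _ _ _ _]/z in z0.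
have szI := inv_size I.
have cost : (c_op u + (bodyT d q u bar A st).1)%:R <= h n + (100 * (n * w))%:R.
  have [_ _ hz] := barP z0; apply: le_trans (lerD hz (lexx _)).
  by rewrite -natrD ler_nat; apply: bodyT_cost.
suff [I' lt'] : invariant st' /\ (size (O_ st') < size (O_ st))%N by split.
rewrite /st' bodyT_val -/z -/g -/i -/j; cbv zeta; case: eqP => gz.
  have lt : (size [seq s <- O_ st | ~~ (i < s < j)%N] < size (O_ st))%N.
    by apply: (size_filter_lt oO); rewrite ioj.
  split=> //; split=> /=; [exact: inv_sys|exact: inv_xi| | |lia].
  - by move=> s; rewrite mem_filter => /andP[_]; exact: inv_open.
  - move=> i' j' m cij' imj'; rewrite mem_filter.
    have [mO|] := inv_gap I cij' imj'; last by right.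
    case: (boolP (i < m < j)%N) => [imj|]; last by left.
    (* A dropped slope identifies its gap with the one just hit, where the lines meet on [g]. *)
    by have [<- <-] := consecutive_uniq cij cij' imj imj'; right.
set s0 := new_slope d q bar A z.1.
have sU x : 0 <= x -> g x <= g z.1 + s0%:R * (x - z.1).
  move=> x0; apply: le_trans (g_support z0 x0).
  by have [_ + _] := barP x0; apply.
have is0j : (i < s0 < j)%N.
  apply: (@slope_between R u g i _ j _ s0 ij (tE i iS) (tE j jS) _ sU); exact/eqP.
have [is0 s0j] := andP is0j.
have s0S : s0 \notin S_ st.
  by apply/negP => /(fun sS => let: And4 _ _ _ H := cij in H s0 sS); lia.
(* The lines of this gap meet off the graph, so by the invariant none of its slopes has been
   dropped. *)
have open_in m : (i < m < j)%N -> m \in O_ st.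
  by move=> /(inv_gap I cij) [] // /gz.
have lt : (size [seq s <- O_ st | s != s0] < size (O_ st))%N.
  by apply: (size_filter_lt (open_in s0 is0j)); rewrite eqxx.
have neS s : s \in S_ st -> (s == s0) = false.
  by move=> sS; apply/eqP => se; rewrite -se sS in s0S.
have sF := fun c => @g_support z.1 c z0; rewrite -/s0 in sF.
clearbody s0; clearbody z.
split=> //; split=> /=; last by rewrite addSnnS;
  exact: leq_trans (leq_add (leqnn _) lt) szI.
- split=> /=.
  + by rewrite inE (slope0_in (inv_sys I)) orbT.
  + by rewrite inE (slopeN_in (inv_sys I)) orbT.
  + move=> s; rewrite inE => /orP[/eqP->|]; last exact: (slope_le (inv_sys I)).
    exact: leq_trans (ltnW s0j) (slope_le (inv_sys I) jS).
  + by rewrite neS ?(slopeN_in (inv_sys I)) // (ptN (inv_sys I)).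
  + move=> s; rewrite inE; case: (eqVneq s s0) => [-> _|_ /=]; last exact: tE.
    split; first exact: sU.
    by exists z.1 => //; rewrite /line subrr mulr0 addr0.
- move=> s c; rewrite inE; case: (eqVneq s s0) => [-> _ c0|_ /=].
    exact: sF.
  exact: inv_xi.
- move=> s; rewrite mem_filter inE => /andP[/negPf-> /(inv_open I)].
  by [].
- move=> i' j' m cij' imj'.
  have [ms0 [imj|[cS ni nj]]] := consecutive_insert cij is0j cij' imj'.
    by left; rewrite mem_filter ms0 open_in.
  rewrite (negPf ni) (negPf nj) mem_filter ms0.
  by case: (inv_gap I cS imj'); [left|right].
Qed.

Lemma loop_total st : invariant st -> exists st' t,
  [/\ loop_runs d q u bar A st st' t, invariant st', O_ st' = [::]
    & t%:R <= (size (O_ st))%:R * (h n + (100 * (n * w))%:R) + (c_op u)%:R].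
Proof.
have [N ltN] := ubnP (size (O_ st)); elim: N st ltN => // N IH st ltN I.
case: (eqVneq (O_ st) [::]) => [O0|/eqP On].
  by exists st, (c_op u); split=> //; [exact: loop_stop | rewrite O0 mul0r add0r].
have [I' lt' cost] := bodyT_step I On.
have [|st' [t [run Ist' O' tle]]] := IH _ _ I'; first exact: leq_trans lt' _.
exists st', (c_op u + (bodyT d q u bar A st).1 + t)%N; split=> //.
  exact: loop_step.
rewrite natrD; apply: le_trans (lerD cost tle) _.
(* The bound for a round dominates a number of steps, hence is nonnegative, and the total bound
   grows with the number of rounds. *)
have W0 : 0 <= h n + (100 * (n * w))%:R by apply: le_trans cost; exact: ler0n.
rewrite addrA lerD2r -[X in X + _]mul1r -mulrDl addrC natr1.
by rewrite ler_wpM2r // ler_nat.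
Qed.

Lemma finalT_val st : (finalT u A st).2 =
  [seq (i, kink u n.-1 (S_ st) (pt st) i, xi st i) | i <- S_ st].
Proof.
rewrite /finalT bindT_val sizeT_val -/n mapT_val; apply: eq_map => i.
rewrite bindT_val -[(op u 1 _).2]/(i == n.-1) /kink.
by case: ifP => _ //; rewrite !bindT_val filterT_val.
Qed.

Lemma finalT_cost st : (size (S_ st) <= n.+1)%N ->
  ((finalT u A st).1 <= 60 * (n * (n * w)))%N.
Proof.
move=> Sn; rewrite /finalT bindT_cost sizeT_cost -/n.
have S2 : (size (S_ st) <= 2 * n)%N by rewrite /n /= in Sn *; lia.
have n1 : (1 <= n)%N by [].
(* Scanning and minimizing over at most 2n slopes takes 8n + 2 operations, and 14 more remain per
   entry; 8n + 16 is at most 24n. *)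
apply: (@leq_trans ((n.*2 * c_op u + c_op u) +
                    (size (S_ st) * (24 * (n * w) + c_op u) + c_op u))).
  rewrite leq_add2l; apply: mapT_cost => i.
  rewrite bindT_cost.
  case: ifP => _ /=.
    have : (1 * c_op u <= n * c_op u)%N by rewrite leq_mul2r n1 orbT.
    by rewrite /w; lia.
  rewrite (@filterT_cost u _ _ (1 * c_op u)%N) // minT_cost filterT_val.
  set T := filter _ _; have : (size T <= size (S_ st))%N by rewrite size_filter count_size.
  move: (size T) => b bS /=.
  have := leq_mul (leq_trans bS S2) (leqnn (c_op u)).
  have := leq_mul S2 (leqnn (c_op u)); have := leq_mul n1 (leqnn (c_op u)).
  by rewrite /w; lia.
have : (c_op u <= w)%N by rewrite /w leq_addr.
move: w (c_op u) (size _) S2 n1 => W b a; move: n => N.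
by clear; nia.
Qed.

Lemma final_computes_g st : invariant st -> O_ st = [::] ->
  computes_g d q A (finalT u A st).2.
Proof.
move=> I O0; rewrite finalT_val.
set K := kink u n.-1 (S_ st) (pt st); set out := [seq _ | _ <- _].
have sys := inv_sys I.
have hit i j cij := complete_meet I O0 (i := i) (j := j) cij.
have outP e : e \in out -> exists2 i, i \in S_ st & e = (i, K i, xi st i).
  by move=> /mapP.
have inP i : i \in S_ st -> (i, K i, xi st i) \in out.
  by move=> iS; apply/mapP; exists i.
split.
- move=> c c0; suff -> : output_fun out c = g c by exact: g_is_min.
  rewrite /output_fun -map_comp; exact: (interpolate_kinks g_support_ex g0 sys hit).
- move=> e /outP[i iS ->] /=.
  have [K0 gK _] := kinkP g0 sys hit iS.
  by split=> //; rewrite -gK; exact: g_is_min.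
- move=> c c0; have [i [iS Kc cK]] := piece_exists u sys c0.
  exists (i, K i, xi st i); split=> //=; first exact: inP.
  by move=> e /outP[i' iS' ->] /=; exact: cK.
- move=> c e [/outP[i iS ->]] /= Kc cK y.
  have [K0 _ _] := kinkP g0 sys hit iS.
  have c0 := le_trans K0 Kc; have [_ gle _] := barP c0.
  (* The objective of the barycenter is below its line, which equals [g] on this piece. *)
  apply: le_trans (inv_xi I iS c0) _; apply: le_trans (gle y).
  rewrite -(piece_line g_support_ex g0 sys hit iS Kc) // => i' iS' ii'.
  by have := cK _ (inP _ iS'); apply.
Qed.

End Algorithm.

(** * Correctness of a full run and the total time bound *)

Theorem theorem31 (R : realType) (k : nat)
    (d : 'rV[R]_k -> 'rV[R]_k -> R) (q : R) (u : unit_costs) (h : nat -> R)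
    (d_metric : is_metric d) (q_ge1 : 1 <= q)
    (h_linear : exists2 b : R, 0 < b &
       forall n : nat, (0 < n)%N -> b * n%:R <= h n) :
  exists K : R, forall (bar : solver R k) (A : seq 'rV[R]_k),
    uniq A -> A != [::] -> solves_within d q bar h A ->
    exists (out : output R k) (t : nat),
      [/\ T_runs d q u bar A out t,
          computes_g d q A out
        & t%:R <= K * ((size A)%:R * h (size A))].
Proof.
have [b b0 hb] := h_linear.
set w := (c_op u + c_dist u)%N.
(* At most n + 1 solver calls cost at most 2n h(n). The other work is at most 171 n^2 w with 171 =
   10 + 100 + 1 + 60 from initialization, rounds, last loop test and output; the lower bound on [h]
   turns n w into (w / b) h(n). *)
exists (2 + 171 * (w%:R / b)) => bar [//|a1 A'] _ _ bar_solves.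
have d0 : d a1 a1 = 0 by apply/(metric_eq0 d_metric).
have q0 : q != 0 by rewrite gt_eqF // (lt_le_trans ltr01).
have I0 := initT_invariant u bar_solves d0 q0.
have [st [t [run I O0 tle]]] := loop_total bar_solves I0.
exists (finalT u (a1 :: A') st).2.
exists ((initT u bar a1 (a1 :: A')).1 + t + (finalT u (a1 :: A') st).1)%N.
split; [exact: T_run|exact: (final_computes_g bar_solves I O0)|].
set n := size (a1 :: A') in tle *.
have costI := initT_cost u bar_solves; rewrite -/w -/n in costI.
have Sn : (size (S_ st) <= n.+1)%N by apply: leq_trans (inv_size I); rewrite leq_addr.
have costF := finalT_cost u Sn; rewrite -/n -/w in costF.
have sO : (size (O_ (initT u bar a1 (a1 :: A')).2) <= n)%N.
  by rewrite initT_val size_iota leq_subr.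
have cw : (c_op u)%:R <= w%:R :> R by rewrite ler_nat leq_addr.
have n1 : 1 <= n%:R :> R by rewrite ler1n.
have bh : b * n%:R <= h n by apply: hb.
have {}tle : t%:R <= n%:R * (h n + (100 * (n * w))%:R) + w%:R.
  apply: le_trans tle _; apply: lerD cw; rewrite ler_wpM2r ?ler_nat //.
  by rewrite addr_ge0 ?ler0n // (le_trans _ bh) // mulr_ge0 ?ler0n // ltW.
have {}costF : ((finalT u (a1 :: A') st).1)%:R <= (60 * (n * (n * w)))%:R :> R.
  by rewrite ler_nat.
have bh0 := bh; have {}bh : w%:R * n%:R <= w%:R / b * h n.
  by rewrite mulrAC ler_pdivlMr // -mulrA ler_wpM2l ?ler0n // mulrC.
have H0 : 0 <= h n by rewrite (le_trans _ bh0) // mulr_ge0 ?ler0n // ltW.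
move: costI tle costF; move: (initT _ _ _ _).1 (finalT _ _ _).1 => ci cf.
clearbody w n; rewrite !natrD !natrM.
move: (h n) (w%:R : R) (w%:R / b) (n%:R : R) bh n1 (ler0n R w) H0 => H W V N bh n1 W0 H0.
(* With the nonlinear comparisons supplied by hand, the rest is linear in the products. *)
have NH : 1 * H <= N * H by rewrite ler_wpM2r.
have NW : 1 * W <= N * W by rewrite ler_wpM2r.
have NNW : 1 * (N * W) <= N * (N * W).
  by rewrite ler_wpM2r // mulr_ge0 // (le_trans ler01).
have NVH : N * (W * N) <= N * (V * H) by rewrite ler_wpM2l // (le_trans ler01).
lra.
Qed.
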